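(* $$\mathbf{W}(3)=\frac{2}{1-\tau^*(3)},$$ where $\mathbf{W}(3)=\lim_{n\to\infty}\mathrm{wR}(n,3)$ is the weighted Ramsey limit for $k=3$ and $\tau^*(3)=\lim_{n\to\infty}\tau^*(n,3)/\binom{n}{2}$ is the normalized limit of the minimum fractional packing number of monochromatic triangles in $2$-edge-colorings of $K_n$.
   Context: Weighted Ramsey number: for $n\ge 3$, $\mathrm{wR}(n,3)$ is the minimum $q$ such that there is an assignment of nonnegative real weights to the edges of $K_n$ with total sum $\binom{n}{2}$, and a Red/Blue coloring of the edges of the same $K_n$, such that in every complete $3$-vertex subgraph $H$ of $K_n$, the sum of the weights on Red edges of $H$ is at most $q$ and the sum of the weights on Blue edges of $H$ is at most $q$. $\mathbf{W}(3):=\lim_{n\to\infty}\mathrm{wR}(n,3)$ (this limit exists, by monotonicity in $n$ and boundedness). Fractional triangle packing number: for a graph $G$, let $\mathcal{T}_3(G)$ be the set of triangles (complete $3$-vertex subgraphs) of $G$. Then $$\tau^*(G)=\max\sum_{T\in\mathcal{T}_3(G)}g(T)$$ over all functions $g:\mathcal{T}_3(G)\to\mathbb{R}$ with $g(T)\ge 0$ for all $T\in\mathcal{T}_3(G)$ and $\sum_{T\in\mathcal{T}_3(G),\,T\ni e}g(T)\le 1$ for every $e\in E(G)$, where $T\ni e$ means that $e$ is an edge of $T$. Let $\tau^*(n,3):=\min\{\tau^*(R)+\tau^*(B)\}$, the minimum over all $2$-edge-colorings of $K_n$, where $R$ and $B$ are the graphs formed by the two color classes. Let $\tau^*(3):=\lim_{n\to\infty}\tau^*(n,3)/\binom{n}{2}$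 (this limit exists, by monotonicity and boundedness). *)

(* Defs.v *)
From HB Require Import structures.
From mathcomp Require Import all_boot all_order all_algebra.
From mathcomp Require Import all_classical all_reals all_analysis.
Set Implicit Arguments.
Unset Strict Implicit.
Unset Printing Implicit Defensive.
Import Order.TTheory GRing.Theory Num.Theory.
Import numFieldNormedType.Exports.
Local Open Scope classical_set_scope.
Local Open Scope ring_scope.

(* A graph on a finite vertex type V is represented by its edge set, a set of
   2-element subsets of V; a triangle is represented by its vertex set. *)
Definition complete_edges (V : finType) : {set {set V}} :=
  [set e : {set V} | #|e| == 2]%SET.

Definition triangles (V : finType) (G : {set {set V}}) : {set {set V}} :=
  [set T : {set V} | (#|T| == 3) &&
     ([set e in complete_edges V | e \subset T] \subset G)]%SET.

(* Red is true and Blue is false; only the values on 2-element sets matter. *)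
Definition coloring (n : nat) := {ffun {set 'I_n} -> bool}.

Definition color_class (n : nat) (c : coloring n) (b : bool) :
    {set {set 'I_n}} :=
  [set e in complete_edges 'I_n | c e == b]%SET.

Definition wR_feasible_for (R : realType) (n : nat) (c : coloring n)
    (w : {set 'I_n} -> R) (q : R) : Prop :=
  [/\ forall e, e \in complete_edges 'I_n -> 0 <= w e,
      \sum_(e in complete_edges 'I_n) w e = 'C(n, 2)%:R
    & forall H, H \in triangles (complete_edges 'I_n) -> forall b : bool,
        \sum_(e in color_class c b | e \subset H) w e <= q].

Definition wR_feasible (R : realType) (n : nat) (q : R) : Prop :=
  exists (w : {set 'I_n} -> R) (c : coloring n), wR_feasible_for c w q.

(* This infimum is a minimum for n >= 3, see wR_min. *)
Definition wR (R : realType) (n : nat) : R :=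
  inf [set q : R | wR_feasible n q].

Definition W3 (R : realType) : R := limn (@wR R).

Definition fractional_packing (R : realType) (V : finType)
    (G : {set {set V}}) (g : {set V} -> R) : Prop :=
  (forall T, T \in triangles G -> 0 <= g T) /\
  (forall e, e \in G -> \sum_(T in triangles G | e \subset T) g T <= 1).

(* This supremum is a maximum, see packing_number_max. *)
Definition packing_number (R : realType) (V : finType)
    (G : {set {set V}}) : R :=
  sup [set \sum_(T in triangles G) g T | g in @fractional_packing R V G].

Definition coloring_packing (R : realType) (n : nat) (c : coloring n) : R :=
  packing_number R (color_class c true) +
  packing_number R (color_class c false).

(* This infimum is a minimum, see tau_star_min. *)
Definition tau_star (R : realType) (n : nat) : R :=
  inf (range (@coloring_packing R n)).

Definition tau_density (R : realType) (n : nat) : R :=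
  tau_star R n / 'C(n, 2)%:R.

Definition tau3 (R : realType) : R := limn (@tau_density R).

Section Attainment.
Variable R : realType.

Lemma inf_of_min (A : set R) (m : R) : A m -> lbound A m -> inf A = m.
Proof.
move=> Am lbm; apply/eqP; rewrite eq_le; apply/andP; split.
  by apply: ge_inf => //; exists m.
by apply: lb_le_inf => //; exists m.
Qed.

Lemma sup_of_max (A : set R) (m : R) : A m -> ubound A m -> sup A = m.
Proof.
move=> Am ubm; apply/eqP; rewrite eq_le; apply/andP; split.
  by apply: ge_sup => //; exists m.
by apply: ub_le_sup => //; exists m.
Qed.

Lemma finite_argmin (T : finType) (f : T -> R) (x0 : T) :
  exists x, forall y, f x <= f y.
Proof.
by case: (@Order.TotalTheory.arg_minP _ _ _ x0 predT f) => // x _ h; exists x => y; exact: h.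
Qed.

Definition lp_feasible (I : finType) (K : Type) (a : K -> I -> R) (b : K -> R)
    (M : R) (x : I -> R) : Prop :=
  (forall i, 0 <= x i <= M) /\ forall k, \sum_i a k i * x i <= b k.

Lemma lp_min (I : finType) (K : Type) (a : K -> I -> R) (b : K -> R) (M : R)
    (obj : I -> R) :
  (exists x, lp_feasible a b M x) ->
  exists2 x, lp_feasible a b M x &
    forall y, lp_feasible a b M y -> \sum_i obj i * x i <= \sum_i obj i * y i.
Proof.
move=> [x0 fx0].
pose cf (v : 'rV[R]_#|I|) (i : I) : R := v ord0 (enum_rank i).
pose mk (x : I -> R) : 'rV[R]_#|I| := \row_j x (enum_val j).
have cfK x : cf (mk x) = x by apply/funext => i; rewrite /cf mxE enum_rankK.
have lin_cont (l : I -> R) :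
    continuous (fun v : 'rV[R]_#|I| => \sum_i l i * cf v i).
  apply: (@continuous_big _ _ _ _ _ add_continuous) => i _ v.
  apply: (@cvgMl_tmp _ _ _ (nbhs_filter v)).
  exact: (@coord_continuous R 1 #|I| ord0 (enum_rank i) v).
pose B := [set v : 'rV[R]_#|I| | forall j, `[0, M]%classic (v ord0 j)].
have cB : compact B.
  apply: (@rV_compact R _ (fun=> `[0, M]%classic)) => j.
  exact: segment_compact.
pose F := B `&` \bigcap_(k in [set: K]) [set v | \sum_i a k i * cf v i <= b k].
have FE v : F v <-> lp_feasible a b M (cf v).
  split=> [[Bv hv]|[Bv hv]].
    by split=> [i|k]; [have := Bv (enum_rank i); rewrite /= in_itv|exact: hv].
  split=> [j|k _]; last exact: hv.
  by have := Bv (enum_val j); rewrite /cf enum_valK /= in_itv.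
have cF : compact F.
  apply: compact_closedI => //; apply: closed_bigI => k _.
  have /continuous_closedP/(_ _ (@closed_le R (b k))) := lin_cont (a k).
  exact.
have F0 : F !=set0 by exists (mk x0); apply/FE; rewrite cfK.
have cont : {within F, continuous (fun v => \sum_i obj i * cf v i)}.
  exact/continuous_subspaceT/lin_cont.
have [v /set_mem/FE fv minv] := compact_EVT_min F0 cF cont.
exists (cf v) => // y fy; have := minv (mk y); rewrite cfK; apply.
by apply/mem_set/FE; rewrite cfK.
Qed.

Lemma triangle_edge (V : finType) (G : {set {set V}}) (T : {set V}) :
  T \in triangles G -> exists2 e, e \in G & e \subset T.
Proof.
rewrite inE => /andP[/eqP T3 /fintype.subsetP sT].
have /card_gt0P[x xT] : (0 < #|T|)%N by rewrite T3.
exists (T :\ x)%SET; last exact: subsetDl.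
by apply: sT; rewrite !inE subsetDl andbT; have := cardsD1 x T; rewrite xT T3 add1n => -[<-].
Qed.

Lemma packing_number_max (V : finType) (G : {set {set V}}) :
  exists g, [/\ @fractional_packing R V G g,
    packing_number R G = \sum_(T in triangles G) g T &
    forall h, fractional_packing G h ->
      \sum_(T in triangles G) h T <= packing_number R G].
Proof.
pose a (e T : {set V}) : R :=
  ((e \in G) && ((T \in triangles G) && (e \subset T)))%:R.
pose obj (T : {set V}) : R := - (T \in triangles G)%:R.
have objE g : \sum_T obj T * g T = - \sum_(T in triangles G) g T.
  rewrite [in RHS]big_mkcond -sumrN; apply: eq_bigr => T _.
  by rewrite /obj; case: ifP => _; rewrite ?mulN1r // oppr0 mul0r.
have aE e g : e \in G ->
    \sum_T a e T * g T = \sum_(T in triangles G | e \subset T) g T.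
  move=> eG; rewrite [RHS]big_mkcond; apply: eq_bigr => T _.
  by rewrite /a eG /=; case: (_ && _); rewrite ?mul1r ?mul0r.
have aP g : (forall e, \sum_T a e T * g T <= 1) <->
    (forall e, e \in G -> \sum_(T in triangles G | e \subset T) g T <= 1).
  split=> h e; first by move=> eG; rewrite -aE.
  have [eG|eG] := boolP (e \in G); first by rewrite aE // h.
  by rewrite big1 // => T _; rewrite /a (negbTE eG) mul0r.
pose trunc (g : {set V} -> R) T := if T \in triangles G then g T else 0.
have truncE (P : pred {set V}) g :
    \sum_(T in triangles G | P T) trunc g T = \sum_(T in triangles G | P T) g T.
  by apply: eq_bigr => T /andP[tT _]; rewrite /trunc tT.
have truncP g : fractional_packing G g ->
    lp_feasible a (fun=> 1) 1 (trunc g).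
  move=> [g0 g1]; split; last by apply/aP => e eG; rewrite truncE g1.
  move=> T; rewrite /trunc; case: ifPn => [tT|_]; last by rewrite lexx ler01.
  rewrite g0 //=; have [e eG eT] := triangle_edge tT.
  apply: le_trans (g1 _ eG); rewrite (bigD1 T) ?tT //= lerDl sumr_ge0 //.
  by move=> U /andP[/andP[tU _] _]; exact: g0.
have [|x [x01 /aP x1] xmin] := @lp_min _ _ a (fun=> 1) 1 obj.
  exists (trunc (fun=> 0)); apply: truncP; split=> // e _.
  by rewrite big1 ?ler01.
have px : fractional_packing G x.
  by split=> // T _; case/andP: (x01 T).
have mx h : fractional_packing G h ->
    \sum_(T in triangles G) h T <= \sum_(T in triangles G) x T.
  move=> ph; have := xmin _ (truncP _ ph); rewrite !objE lerN2.
  rewrite (_ : \sum_(T in _) trunc h T = \sum_(T in triangles G) h T) //.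
  by apply: eq_bigr => T tT; rewrite /trunc tT.
have E : packing_number R G = \sum_(T in triangles G) x T.
  by apply: sup_of_max; [exists x|move=> _ [h ph <-]; exact: mx].
by exists x; split=> // h; rewrite E; exact: mx.
Qed.

Lemma tau_star_min (n : nat) :
  exists c : coloring n, tau_star R n = coloring_packing R c /\
    forall d : coloring n, tau_star R n <= coloring_packing R d.
Proof.
have [c cmin] := finite_argmin (@coloring_packing R n) [ffun=> true].
have E : tau_star R n = coloring_packing R c.
  by apply: inf_of_min => [|_ [d _ <-]]; [exists c|exact: cmin].
by exists c; split=> // d; rewrite E.
Qed.

Lemma wR_feasible_for_min (n : nat) (c : coloring n) : (3 <= n)%N ->
  exists (w : {set 'I_n} -> R) q, wR_feasible_for c w q /\
    forall w' q', wR_feasible_for c w' q' -> q <= q'.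
Proof.
move=> n3; pose E := complete_edges 'I_n; pose M : R := 'C(n, 2)%:R.
have [H0 tH0] : exists H0, H0 \in triangles E.
  have : (0 < #|[set T : {set 'I_n} | #|T| == 3]%SET|)%N.
    by rewrite card_draws card_ord bin_gt0.
  move=> /card_gt0P[T]; rewrite inE => T3; exists T; rewrite inE T3 /=.
  by apply/fintype.subsetP => e; rewrite inE => /andP[].
have cE b e : e \in color_class c b -> e \in E by rewrite inE => /andP[].
pose tr (w : {set 'I_n} -> R) e := if e \in E then w e else 0.
pose ext (w : {set 'I_n} -> R) (q : R) (o : option {set 'I_n}) :=
  if o is Some e then w e else q.
pose a (k : bool + {set 'I_n} * bool) (o : option {set 'I_n}) : R :=
  match k, o with
  | inl s, Some e => (-1) ^+ s * (e \in E)%:R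
  | inl s, None => 0
  | inr (H, b), Some e => ((H \in triangles E) &&
                           ((e \in color_class c b) && (e \subset H)))%:R
  | inr (H, b), None => - (H \in triangles E)%:R
  end.
pose bd (k : bool + {set 'I_n} * bool) : R :=
  if k is inl s then (-1) ^+ s * M else 0.
pose obj (o : option {set 'I_n}) : R := if o is Some _ then 0 else 1.
have sumO (F : option {set 'I_n} -> R) :
    \sum_o F o = F None + \sum_e F (Some e).
  rewrite (bigD1 None) //=; congr (_ + _).
  rewrite (reindex_omap Some id) /=; last by case.
  by apply: eq_bigl => e; rewrite eqxx.
have objE x : \sum_o obj o * x o = x None.
  by rewrite sumO mul1r big1 ?addr0 // => e _; rewrite mul0r.
have aEl s x : \sum_o a (inl s) o * x o = (-1) ^+ s * \sum_(e in E) x (Some e).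
  rewrite sumO mul0r add0r big_distrr [RHS]big_mkcond; apply: eq_bigr => e _ /=.
  by case: ifP => _; rewrite ?mulr1 // mulr0 mul0r.
have aEr H b x : H \in triangles E -> \sum_o a (inr (H, b)) o * x o =
    \sum_(e in color_class c b | e \subset H) x (Some e) - x None.
  move=> tH; rewrite sumO /= tH mulN1r addrC; congr (_ - _).
  rewrite [RHS]big_mkcond; apply: eq_bigr => e _ /=.
  by case: (_ && _); rewrite ?mul1r ?mul0r.
have aEr0 H b x : H \notin triangles E -> \sum_o a (inr (H, b)) o * x o = 0.
  by move=> tH; rewrite sumO /= (negbTE tH) oppr0 mul0r big1 ?addr0 // => e _; rewrite mul0r.
have q0 (w : {set 'I_n} -> R) q : wR_feasible_for c w q -> 0 <= q.
  move=> [w0 _ wq]; apply: le_trans (wq _ tH0 true).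
  by apply: sumr_ge0 => e /andP[/cE ? _]; exact: w0.
have trE (P : pred {set 'I_n}) w : {subset P <= E} ->
    \sum_(e | P e) tr w e = \sum_(e | P e) w e.
  by move=> PE; apply: eq_bigr => e /PE eE; rewrite /tr eE.
have M0 : 0 <= M by rewrite ler0n.
have to_lp w q : wR_feasible_for c w q -> q <= M ->
    lp_feasible a bd M (ext (tr w) q).
  move=> fwq qM; have q_ge0 := q0 _ _ fwq; case: fwq => w0 w1 wq; split.
    case=> [e|] /=; last by rewrite q_ge0.
    rewrite /tr; case: ifPn => [eE|_]; last by rewrite lexx.
    rewrite w0 //= /M -w1 (bigD1 e) //= lerDl sumr_ge0 // => f /andP[fE _].
    exact: w0.
  case=> [s|[H b]].
    by rewrite aEl /= (trE (mem E)) // w1.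
  have [tH|tH] := boolP (H \in triangles E); last by rewrite aEr0.
  rewrite aEr //= subr_le0 trE ?wq // => e; rewrite unfold_in => /andP[/cE].
  by [].
have of_lp x : lp_feasible a bd M x -> wR_feasible_for c (x \o Some) (x None).
  move=> [x0 xk]; split=> [e _| |H tH b].
  - by case/andP: (x0 (Some e)).
  - apply/eqP; rewrite eq_le; have := xk (inl false); have := xk (inl true).
    by rewrite !aEl /= expr1 expr0 !mulN1r !mul1r lerN2 => -> ->.
  - by have := xk (inr (H, b)); rewrite aEr //= subr_le0.
have f1 : wR_feasible_for c (fun=> 1) M.
  have EM : \sum_(e in E) 1 = M.
    rewrite sumr_const /M; congr (_%:R).
    by rewrite /E /complete_edges card_draws card_ord.
  split=> // H tH b; rewrite -EM [leLHS]big_mkcond [leRHS]big_mkcond /=.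
  apply: ler_sum => e _; case: ifP => [/andP[/cE -> _]//|_].
  by case: ifP.
have [|x fx xmin] := @lp_min _ _ a bd M obj.
  by exists (ext (tr (fun=> 1)) M); exact: to_lp.
exists (x \o Some), (x None); split; first exact: of_lp.
move=> w q fwq; have [qM|/ltW Mq] := leP q M.
  by have := xmin _ (to_lp _ _ fwq qM); rewrite !objE.
by apply: le_trans Mq; case: fx => /(_ None)/andP[].
Qed.

Lemma wR_min (n : nat) : (3 <= n)%N ->
  wR_feasible n (wR R n) /\ forall q : R, wR_feasible n q -> wR R n <= q.
Proof.
move=> n3; have /choice[f fP] : forall c : coloring n, exists q : R,
    (exists w, wR_feasible_for c w q) /\
    forall w' q', wR_feasible_for c w' q' -> q <= q'.
  by move=> c; have [w [q [h1 h2]]] := wR_feasible_for_min c n3; exists q; split=> //; exists w.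
have [c cmin] := finite_argmin f [ffun=> true].
have [[w wc] _] := fP c.
have lb q : wR_feasible n q -> f c <= q.
  move=> [w' [d fd]]; apply: le_trans (cmin d) _.
  by have [_ h] := fP d; exact: h fd.
have fc : wR_feasible n (f c) by exists w, c.
have E : wR R n = f c by exact: inf_of_min.
by rewrite E.
Qed.

End Attainment.

(* Main.v *)
Require Import Defs.
From mathcomp Require Import all_boot all_order all_algebra.
From mathcomp Require Import all_classical all_reals all_analysis.
From mathcomp Require Import ring lra.
Import Order.TTheory GRing.Theory Num.Theory.
Import numFieldNormedType.Exports.
Local Open Scope classical_set_scope.
Local Open Scope ring_scope.

(** Fix a coloring c of K_n, put M = 'C(n, 2), and let tau be the sum of the
    fractional triangle packing numbers of the two color classes.
    By LP duality the triangles of each class have a fractional cover t of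
    total weight equal to the packing number, and t <= 1 without loss of
    generality. The weights (1 - t) / 2 have total (M - tau) / 2 and give every
    monochromatic part of a triangle weight at most 1, so after rescaling
    wR(n) <= 2M / (M - tau).
    Conversely, let weights w of total M be feasible for q. Split the weight of
    each edge according to an optimal packing g: the packed part contributes at
    most q * tau. On the rest, an edge weighs at most q / 2 unless it belongs to
    a matching of its color, since two adjacent edges of one color lie in a
    common triangle; hence 2M <= q (M - tau + n).
    The two bounds differ by O(1/n), and the density of tau is nondecreasing in
    n by averaging over vertex-deleted subgraphs. *)

(** * Approximate LP duality by penalization *)

Lemma continuous_box_max (R : realType) (I : finType) (M : R)
    (F : (I -> R) -> R) : 0 <= M ->
  continuous (fun v : 'rV[R]_#|I| => F (fun i => v ord0 (enum_rank i))) ->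
  exists2 x : I -> R, forall i, 0 <= x i <= M &
    forall y, (forall i, 0 <= y i <= M) -> F y <= F x.
Proof.
move=> M0 cF.
pose B := [set v : 'rV[R]_#|I| | forall j, `[0, M]%classic (v ord0 j)].
have cB : compact B.
  apply: (@rV_compact R _ (fun=> `[0, M]%classic)) => j.
  exact: segment_compact.
have B0 : B !=set0 by exists 0 => j; rewrite /= mxE in_itv /= lexx.
have [v /set_mem Bv maxv] := compact_EVT_max B0 cB (continuous_subspaceT cF).
exists (fun i => v ord0 (enum_rank i)) => [i|y y01].
  by have := Bv (enum_rank i); rewrite /= in_itv.
have := maxv (\row_j y (enum_val j)).
rewrite (_ : (fun i => _) = y); last first.
  by apply/funext => i; rewrite mxE enum_rankK.
by apply; apply/mem_set => j; rewrite /= mxE in_itv; exact: y01.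
Qed.

(** The squared positive part has derivative [2 * Num.max 0 x], which is 2-Lipschitz, so its
    first-order expansion errs by at most [h ^+ 2], for [h] of either sign. *)
Lemma sqr_pos_part_shift (R : realType) (x h : R) :
  Num.max 0 (x + h) ^+ 2 <= Num.max 0 x ^+ 2 + 2 * h * Num.max 0 x + h ^+ 2.
Proof.
have [x0|x0] := leP 0 x; have [xh0|xh0] := leP 0 (x + h); rewrite ?expr2; nra.
Qed.

(** First-order optimality without derivatives: for positive [a], a step [h] below [a / (b + 1)]
    would make the linear term beat the quadratic one. *)
Lemma le_of_small_slope (R : realType) (a b d : R) : 0 < d -> 0 <= b ->
  (forall h, 0 < h <= d -> h * a <= b * h ^+ 2) -> a <= 0.
Proof.
move=> d0 b0 H; rewrite leNgt; apply/negP => a0.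
pose h := Num.min d (a / (2 * (b + 1))).
have b1 : 0 < 2 * (b + 1) by lra.
have h0 : 0 < h by rewrite lt_min d0 divr_gt0.
have hd : h <= d by rewrite ge_min lexx.
have ha : h * (2 * (b + 1)) <= a by rewrite -ler_pdivlMr // ge_min lexx orbT.
have := H h; rewrite h0 hd => /(_ isT).
rewrite expr2 mulrCA ler_pM2l //; nra.
Qed.

(* Approximate LP duality without Farkas: maximize \sum g - K/2 \sum_j p_j^2
   over the box [0, 2]^I, where p_j is the excess over 1 of the packing
   constraint j. The first-order conditions say that t = K * p is a fractional
   cover and that \sum t <= \sum g, while g is a packing up to an error
   O(1/K). *)
Lemma approx_fractional_cover (R : realType) (I J : finType)
    (D : {set I}) (E : {set J}) (inc : J -> I -> bool) (P eps : R) :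
  (forall i, i \in D -> exists2 j, j \in E & inc j i) ->
  (forall g : I -> R, (forall i, i \in D -> 0 <= g i) ->
    (forall j, j \in E -> \sum_(i in D | inc j i) g i <= 1) ->
    \sum_(i in D) g i <= P) ->
  0 < eps ->
  exists t : J -> R, [/\ forall j, 0 <= t j,
    forall i, i \in D -> 1 <= \sum_(j in E | inc j i) t j
    & \sum_(j in E) t j <= P + eps].
Proof.
move=> incD maxP eps0.
have P0 : 0 <= P.
  apply: le_trans (maxP (fun=> 0) _ _) => //; first by rewrite big1.
  by move=> j _; rewrite big1.
(* The final error is at most [P * (2 * #|D|) / K]; this [K] brings it below [eps], and the summand
   1 ensures [1 <= K]. *)
pose K : R := 1 + 2 * P * #|D|%:R / eps.
have K1 : 1 <= K by rewrite lerDl divr_ge0 ?mulr_ge0 // ltW.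
have K0 : 0 < K by exact: lt_le_trans K1.
pose s (g : I -> R) j := \sum_(i in D | inc j i) g i.
pose p (g : I -> R) j := Num.max 0 (s g j - 1).
pose F (g : I -> R) := \sum_(i in D) g i - K / 2 * \sum_(j in E) p g j ^+ 2.
have cF : continuous
    (fun v : 'rV[R]_#|I| => F (fun i => v ord0 (enum_rank i))).
  have cs (Q : pred I) : continuous
      (fun v : 'rV[R]_#|I| => \sum_(i | Q i) v ord0 (enum_rank i)).
    apply: (@continuous_big _ _ _ _ _ add_continuous) => i _ v.
    exact: (@coord_continuous R 1 #|I| ord0 (enum_rank i) v).
  move=> v; apply: (@cvgB _ _ _ _ (nbhs_filter v)).
    exact: (cs (fun i => i \in D)).
  apply: (@cvgMl_tmp _ _ _ (nbhs_filter v)).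
  apply: (@continuous_big _ _ _ _ _ add_continuous) => j _ u.
  have cp : {for u, continuous
      (fun v : 'rV[R]_#|I| => p (fun i => v ord0 (enum_rank i)) j)}.
    apply: (@continuous_max _ _ (fun=> 0)); first exact: cst_continuous.
    apply: (@cvgB _ _ _ _ (nbhs_filter u)); last exact: cvg_cst.
    exact: (cs (fun i => (i \in D) && inc j i)).
  by rewrite /continuous_at expr2; apply: (@cvgM _ _ _ (nbhs_filter u)).
have [g g02 gmax] := @continuous_box_max R I 2 F (ler0n R 2) cF.
have p0 h j : 0 <= p h j by rewrite le_max lexx.
pose t j := K * p g j.
have t0 j : 0 <= t j by rewrite mulr_ge0 // ltW.
pose c i := \sum_(j in E | inc j i) t j.
(* Moving coordinate [i] by [h] changes [F] by at least [h * (1 - c i)] minus the quadratic term;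
   maximality of [g] forbids a gain. *)
have slope i h : i \in D -> 0 <= g i + h <= 2 ->
    h * (1 - c i) <= K / 2 * #|E|%:R * h ^+ 2.
  move=> iD gih; pose g' k := g k + h * (k == i)%:R.
  have sg' (Q : pred I) : \sum_(k in D | Q k) g' k =
      \sum_(k in D | Q k) g k + h * (Q i)%:R.
    rewrite big_split -mulr_sumr /=; congr (_ + _ * _).
    have [Qi|Qi] := boolP (Q i).
      rewrite (bigD1 i) ?iD //= eqxx big1 ?addr0 // => k /andP[_ /negbTE ->].
      by [].
    by rewrite big1 // => k /andP[_ Qk]; case: eqP Qk Qi => // -> ->.
  have sg'E : \sum_(k in D) g' k = \sum_(k in D) g k + h.
    by have := sg' predT; rewrite !big_mkcondr mulr1.
  have pg' j : p g' j ^+ 2 <=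
      p g j ^+ 2 + 2 * h * (if inc j i then p g j else 0) + h ^+ 2.
    rewrite /p /s sg' addrAC; case: (inc j i).
      by rewrite mulr1; exact: sqr_pos_part_shift.
    by rewrite !mulr0 !addr0 lerDl sqr_ge0.
  have /gmax : forall k, 0 <= g' k <= 2.
    by move=> k; rewrite /g'; case: (k =P i) => [->|_];
      rewrite ?mulr1 ?mulr0 ?addr0.
  rewrite /F sg'E.
  pose q := \sum_(j in E | inc j i) p g j.
  have -> : c i = K * q by rewrite /c /t -mulr_sumr.
  have : \sum_(j in E) p g' j ^+ 2 <= \sum_(j in E) p g j ^+ 2 +
      2 * h * q + #|E|%:R * h ^+ 2.
    apply: le_trans (ler_sum _ (fun j _ => pg' j)) _.
    rewrite !big_split /= sumr_const -mulr_sumr -[h ^+ 2 *+ _]mulr_natl.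
    by rewrite /q big_mkcondr.
  set A := \sum_(j in E) p g' j ^+ 2; set B := \sum_(j in E) _.
  nra.
have c1 i : i \in D -> 1 <= c i.
  move=> iD; rewrite -subr_le0.
  (* On the upper face of the box [g i] cannot grow, but a constraint through [i] then has excess at
     least 1, so its [t j] alone is at least [K]. Below that face, small positive steps apply. *)
  have [gi2|gi2] := leP 2 (g i).
    rewrite subr_le0; have [j jE ij] := incD i iD.
    have sj : 2 <= s g j.
      apply: le_trans gi2 _; rewrite /s (bigD1 i) ?iD //= lerDl sumr_ge0 //.
      by move=> k _; case/andP: (g02 k).
    have pj : 1 <= p g j by rewrite le_max; apply/orP; right; lra.
    rewrite /c (bigD1 j) ?jE //=; apply: (@le_trans _ _ (t j)).
      by rewrite /t; nra.
    by rewrite lerDl sumr_ge0.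
  apply: (@le_of_small_slope R _ (K / 2 * #|E|%:R) (2 - g i)).
  - by rewrite subr_gt0.
  - by rewrite mulr_ge0 ?ler0n // divr_ge0 // ltW.
  - by move=> h hh; apply: slope => //; have := g02 i; lra.
(* Complementary slackness: where [g i] is positive, small negative steps are allowed and give
   [c i <= 1]. *)
have gc i : i \in D -> g i * c i <= g i.
  move=> iD; have /andP[gi0 gi2] := g02 i.
  have [gi_gt0|gi_le0] := ltP 0 (g i); last first.
    have -> : g i = 0 by apply/eqP; rewrite eq_le gi_le0.
    by rewrite mul0r.
  rewrite -[leRHS]mulr1 ler_pM2l // -subr_le0.
  apply: (@le_of_small_slope R _ (K / 2 * #|E|%:R) (g i)) => //.
  - by rewrite mulr_ge0 ?ler0n // divr_ge0 // ltW.
  - move=> h /andP[h0 hg]; have := slope i (- h) iD.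
    by rewrite sqrrN mulNr -mulrN opprB; apply; lra.
have dual : \sum_(i in D) g i * c i = \sum_(j in E) t j * s g j.
  rewrite /c; under eq_bigr do rewrite mulr_sumr.
  rewrite (exchange_big_dep (mem E)) /=; last by move=> ? ? _ /andP[].
  apply: eq_bigr => j jE; rewrite /s mulr_sumr jE /=.
  by apply: eq_bigr => i _; rewrite mulrC.
pose S := \sum_(j in E) t j.
have tS j : j \in E -> t j <= S.
  by move=> jE; rewrite /S (bigD1 j) //= lerDl sumr_ge0.
have S0 : 0 <= S by exact: sumr_ge0.
(* The other complementary slackness: [t j] vanishes unless constraint [j] is exceeded. *)
have Sg : S <= \sum_(i in D) g i.
  apply: le_trans (ler_sum _ gc); rewrite dual; apply: ler_sum => j _.
  have [sj|sj] := leP 1 (s g j); first by rewrite ler_peMr.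
  suff -> : t j = 0 by rewrite mul0r.
  by rewrite /t /p max_l ?mulr0 // subr_le0 ltW.
have gS : \sum_(i in D) g i <= 2 * #|D|%:R.
  apply: (@le_trans _ _ (\sum_(i in D) 2)).
    by apply: ler_sum => i _; case/andP: (g02 i).
  by rewrite sumr_const mulr_natr.
have K_S : 0 < 1 + S / K by rewrite ltr_pwDl // divr_ge0 // ltW.
(* Each excess equals [t j / K], hence is at most [S / K], so dividing [g] by [1 + S / K] yields a
   genuine packing. *)
have gP : \sum_(i in D) g i <= P * (1 + S / K).
  rewrite -ler_pdivrMr // mulr_suml; apply: maxP => [i _|j jE].
    by rewrite divr_ge0 ?(ltW K_S) //; case/andP: (g02 i).
  rewrite -mulr_suml ler_pdivrMr // mul1r.
  have : p g j <= S / K by rewrite ler_pdivlMr // mulrC tS.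
  have : s g j - 1 <= p g j by rewrite le_max lexx orbT.
  by rewrite /s; lra.
exists t; split=> //; rewrite -/S; apply: le_trans (le_trans (Sg) gP) _.
rewrite mulrDr mulr1 lerD2l mulrA ler_pdivrMr //.
apply: (@le_trans _ _ (P * (2 * #|D|%:R))).
  by rewrite ler_wpM2l //; apply: le_trans Sg gS.
rewrite /K mulrDr mulr1 [eps * (_ / _)]mulrCA divff ?gt_eqF // mulr1.
by rewrite mulrCA -mulrA lerDr ltW.
Qed.

(** * Edges of triangles and of color classes *)

Lemma card_edges_inside (V : finType) (T : {set V}) :
  #|[set e in complete_edges V | e \subset T]%SET| = 'C(#|T|, 2).
Proof.
by rewrite -cards_draws; apply: eq_card => e; rewrite !inE andbC.
Qed.

Lemma edges_of_triangle (V : finType) (G : {set {set V}}) (T : {set V}) :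
  G \subset complete_edges V -> T \in triangles G ->
  [set e in G | e \subset T]%SET =
  [set e in complete_edges V | e \subset T]%SET.
Proof.
move=> /fintype.subsetP GE; rewrite inE => /andP[_ /fintype.subsetP TG].
apply/setP => e; rewrite !inE; case eT: (e \subset T); rewrite ?andbF ?andbT //.
by apply/idP/idP => [/GE|e2]; [rewrite inE|apply: TG; rewrite !inE e2 eT].
Qed.

Lemma triangle_edge_count (V : finType) (G : {set {set V}}) (T : {set V}) :
  G \subset complete_edges V -> T \in triangles G ->
  #|[set e in G | e \subset T]%SET| = 3%N.
Proof.
move=> GE tT; rewrite edges_of_triangle // card_edges_inside.
by move: tT; rewrite inE => /andP[/eqP ->].
Qed.

Lemma color_class_sub (n : nat) (c : coloring n) b :
  color_class c b \subset complete_edges 'I_n.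
Proof. by apply/fintype.subsetP => e; rewrite inE => /andP[]. Qed.

Lemma sum_color_classes (R : realType) (n : nat) (c : coloring n)
    (F : {set 'I_n} -> R) :
  \sum_(e in color_class c true) F e + \sum_(e in color_class c false) F e =
  \sum_(e in complete_edges 'I_n) F e.
Proof.
rewrite (bigID (fun e => c e) (mem (complete_edges _))) /=.
by congr (_ + _); apply: eq_bigl => e; rewrite [LHS]inE ?eqb_id ?eqbF_neg.
Qed.

Lemma card_color_classes (n : nat) (c : coloring n) :
  (#|color_class c true| + #|color_class c false|)%N = 'C(n, 2).
Proof.
transitivity #|complete_edges 'I_n|; last by rewrite card_draws card_ord.
rewrite -(cardsID [set e | c e] (complete_edges _)).
by congr (_ + _)%N; apply: eq_card => e; rewrite !inE ?eqb_id ?eqbF_neg // andbC.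
Qed.

(** * Fractional triangle packings and covers *)

Lemma packing_exchange (R : realType) (V : finType) (G : {set {set V}})
    (a g : {set V} -> R) :
  \sum_(e in G) a e * (\sum_(T in triangles G | e \subset T) g T) =
  \sum_(T in triangles G) g T * \sum_(e in G | e \subset T) a e.
Proof.
under eq_bigr do rewrite mulr_sumr.
rewrite (exchange_big_dep (mem (triangles G))) /=; last by move=> ? ? _ /andP[].
apply: eq_bigr => T tT; rewrite mulr_sumr tT /=.
by apply: eq_bigr => e _; rewrite mulrC.
Qed.

Lemma packing_edge_total (R : realType) (V : finType) (G : {set {set V}})
    (g : {set V} -> R) : G \subset complete_edges V ->
  \sum_(e in G) (\sum_(T in triangles G | e \subset T) g T) =
  3 * \sum_(T in triangles G) g T.
Proof.
move=> GE; have := packing_exchange R V G (fun=> 1) g.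
under eq_bigr do rewrite mul1r.
move=> ->; rewrite mulr_sumr; apply: eq_bigr => T tT.
rewrite (eq_bigl (mem [set e in G | e \subset T]%SET)); last first.
  by move=> e; rewrite /= inE.
by rewrite sumr_const triangle_edge_count // mulrC.
Qed.

Lemma packing_number_le (R : realType) (V : finType) (G : {set {set V}}) :
  G \subset complete_edges V -> 3 * packing_number R G <= #|G|%:R.
Proof.
move=> GE; have [g [[g0 g1] -> _]] := packing_number_max R G.
rewrite -packing_edge_total //; apply: le_trans (ler_sum _ g1) _.
by rewrite sumr_const.
Qed.

Lemma packing_number_ge0 (R : realType) (V : finType) (G : {set {set V}}) :
  0 <= packing_number R G.
Proof.
have [g [_ _]] := packing_number_max R G.
move=> /(_ (fun=> 0)); rewrite big1 //; apply; split=> // e _.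
by rewrite big1.
Qed.

(** Truncating a cover at 1 keeps it a cover: an edge of weight at least 1 covers its triangles
    alone, and a triangle without such an edge is unaffected. *)
Lemma approx_triangle_cover (R : realType) (V : finType) (G : {set {set V}})
    (eps : R) : 0 < eps ->
  exists t : {set V} -> R, [/\ forall e, 0 <= t e <= 1,
    forall T, T \in triangles G -> 1 <= \sum_(e in G | e \subset T) t e
    & \sum_(e in G) t e <= packing_number R G + eps].
Proof.
move=> eps0; have [_ [_ _ gmax]] := packing_number_max R G.
have [||t [t0 t1 tP]] := @approx_fractional_cover R _ _ (triangles G) G
  (fun e T => e \subset T) (packing_number R G) eps _ _ eps0.
- by move=> T /triangle_edge.
- by move=> g g0 g1; apply: gmax.
exists (fun e => Num.min (t e) 1); split=> [e|T tT|].
- by rewrite le_min t0 ler01 ge_min lexx orbT.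
- have m0 e : 0 <= Num.min (t e) 1 by rewrite le_min t0 ler01.
  have [/existsP[e /andP[/andP[eG eT] te]]|/existsPn small] :=
      boolP [exists e, (e \in G) && (e \subset T) && (1 <= t e)].
    by rewrite (bigD1 e) ?eG ?eT //= min_r // lerDl sumr_ge0.
  apply: le_trans (t1 T tT) _; apply: ler_sum => e eGT.
  by rewrite min_l //; have := small e; rewrite eGT -ltNge => /ltW.
- apply: le_trans tP; apply: ler_sum => e _.
  by rewrite ge_min lexx.
Qed.

(** * Lower bound on the weighted Ramsey number *)

Lemma complete_triangle (V : finType) (T : {set V}) :
  (T \in triangles (complete_edges V)) = (#|T| == 3%N).
Proof.
rewrite inE; case: eqP => //= _; apply/fintype.subsetP => e.
by rewrite inE => /andP[].
Qed.

(** The packed part weighs at most [P * q], the residual part at most [(#|G| - 3 * P) * q / 2], and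
    the heavy edges add at most [#|V| * q / 4]. The bound [q] is needed on all 3-vertex sets, since
    two adjacent edges of [G] need not lie in a triangle of [G]. *)
Lemma weight_le_packing (R : realType) (V : finType) (G : {set {set V}})
    (w : {set V} -> R) (q : R) :
  (2 < #|V|)%N -> G \subset complete_edges V ->
  (forall e, e \in G -> 0 <= w e) ->
  (forall H : {set V}, #|H| = 3%N -> \sum_(e in G | e \subset H) w e <= q) ->
  2 * \sum_(e in G) w e <=
    q * (#|G|%:R - packing_number R G + #|V|%:R / 2).
Proof.
move=> V3 GE w0 wq; have [g [[g0 g1] -> _]] := packing_number_max R G.
set P := \sum_(T in triangles G) g T.
have e2 e : e \in G -> #|e| = 2%N.
  by move=> /(fintype.subsetP GE); rewrite inE => /eqP.
have wmax e : e \in G -> w e <= q.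
  move=> eG; have [x xe] : exists x, x \in ~: e.
    by apply/card_gt0P; rewrite cardsCs finset.setCK subn_gt0 e2.
  apply: (le_trans _ (wq (x |: e)%SET _)).
    rewrite (bigD1 e) /=; last by rewrite eG finset.subsetUr.
    rewrite lerDl sumr_ge0 // => f.
    by case/andP => /andP[/w0].
  by rewrite cardsU1 -finset.in_setC xe e2.
have wpair e f : e \in G -> f \in G -> e != f -> ~~ [disjoint e & f] ->
    w e + w f <= q.
  move=> eG fG ef; rewrite -finset.setI_eq0 => /finset.set0Pn[x].
  rewrite inE => /andP[xe xf].
  have I1 : #|e :&: f| = 1%N.
    apply/eqP; rewrite eqn_leq; apply/andP; split; last first.
      by apply/card_gt0P; exists x; rewrite inE xe.
    rewrite leqNgt; apply: contra ef => I2.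
    have ei : (e :&: f)%SET = e.
      by apply/eqP; rewrite eqEcard finset.subsetIl e2.
    have fi : (e :&: f)%SET = f.
      by apply/eqP; rewrite eqEcard finset.subsetIr e2.
    by rewrite -ei fi.
  apply: (le_trans _ (wq (e :|: f)%SET _)); last first.
    by rewrite cardsU (e2 e eG) (e2 f fG) I1.
  rewrite (bigD1 e) /=; last by rewrite eG finset.subsetUl.
  rewrite (bigD1 f) /=; last first.
    by rewrite fG finset.subsetUr eq_sym.
  rewrite addrA lerDl sumr_ge0 // => h.
  by case/andP => /andP[/andP[/w0]].
have q0 : 0 <= q.
  have : (0 < #|[set T : {set V} | #|T| == 3]%SET|)%N.
    by rewrite card_draws bin_gt0.
  move=> /card_gt0P[T]; rewrite inE => /eqP T3; apply: le_trans (wq T T3).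
  by apply: sumr_ge0 => e /andP[/w0].
(* Two heavy edges sharing a vertex would violate [wpair], so [B] is a matching and has at most
   [#|V| / 2] edges. *)
pose B := [set e in G | q / 2 < w e]%SET.
have trB : finset.trivIset B.
  apply/finset.trivIsetP => e f; rewrite !inE => /andP[eG we] /andP[fG wf] ef.
  apply/negPn/negP => /(wpair e f eG fG ef); lra.
have cardB : (#|B| * 2 <= #|V|)%N.
  apply: leq_trans (max_card (mem (finset.cover B))).
  rewrite -(eqP trB) -sum_nat_const; apply: leq_sum => e.
  by rewrite inE => /andP[/e2 ->].
(* The capacity of [e] left over by the packing, which lies between 0 and 1. *)
pose r (e : {set V}) : R := 1 - \sum_(T in triangles G | e \subset T) g T.
have rw e : e \in G -> r e * w e <= r e * (q / 2) + (e \in B)%:R * (q / 2).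
  move=> eG; have r0 : 0 <= r e by rewrite subr_ge0 g1.
  have r1 : r e <= 1.
    rewrite lerBlDl lerDr sumr_ge0 // => T /andP[tT _]; exact: g0.
  have := wmax e eG; have := w0 e eG.
  by rewrite inE eG /=; case: (ltP (q / 2) (w e)) => wh;
    rewrite ?mul1r ?mul0r; nra.
have split_w : \sum_(e in G) w e =
    \sum_(T in triangles G) g T * \sum_(e in G | e \subset T) w e +
    \sum_(e in G) r e * w e.
  rewrite -packing_exchange -big_split /=; apply: eq_bigr => e _.
  by rewrite /r; ring.
have part1 : \sum_(T in triangles G) g T * \sum_(e in G | e \subset T) w e <=
    P * q.
  rewrite mulr_suml; apply: ler_sum => T tT; rewrite ler_wpM2l ?g0 //.
  by apply: wq; move: tT; rewrite inE => /andP[/eqP].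
have sum_r : \sum_(e in G) r e = #|G|%:R - 3 * P.
  by rewrite sumrB sumr_const packing_edge_total.
have sum_B : \sum_(e in G) (e \in B)%:R = #|B|%:R :> R.
  rewrite -sumr_const [LHS]big_mkcond [RHS]big_mkcond; apply: eq_bigr => e _.
  by rewrite inE; case: (e \in G) => //=; case: ifP.
have part2 : \sum_(e in G) r e * w e <=
    (#|G|%:R - 3 * P) * (q / 2) + #|B|%:R * (q / 2).
  apply: le_trans (ler_sum _ rw) _.
  by rewrite big_split /= -!mulr_suml sum_r sum_B.
have cB : #|B|%:R * 2 <= #|V|%:R :> R by rewrite -natrM ler_nat.
rewrite split_w; nra.
Qed.

Lemma wR_feasible_lower (R : realType) (n : nat) (c : coloring n)
    (w : {set 'I_n} -> R) (q : R) : (2 < n)%N -> wR_feasible_for c w q ->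
  2 * 'C(n, 2)%:R <= q * ('C(n, 2)%:R - coloring_packing R c + n%:R).
Proof.
move=> n3 [w0 w1 wq].
have H b := @weight_le_packing R _ (color_class c b) w q.
have {}H b : 2 * \sum_(e in color_class c b) w e <=
    q * (#|color_class c b|%:R - packing_number R (color_class c b) + n%:R / 2).
  have := H b; rewrite card_ord; apply=> //.
  - exact: color_class_sub.
  - by move=> e /(fintype.subsetP (color_class_sub n c b)); exact: w0.
  - by move=> T T3; apply: wq; rewrite complete_triangle T3.
have := lerD (H true) (H false).
rewrite -mulrDr sum_color_classes w1 -(card_color_classes n c) natrD.
move=> /le_trans; apply; rewrite /coloring_packing le_eqVlt; apply/orP; left.
by apply/eqP; field.
Qed.

(** * Upper bound on the weighted Ramsey number *)

Lemma coloring_packing_le (R : realType) (n : nat) (c : coloring n) :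
  3 * coloring_packing R c <= 'C(n, 2)%:R.
Proof.
rewrite -(card_color_classes n c) natrD mulrDr.
by rewrite lerD // packing_number_le // color_class_sub.
Qed.

Lemma wR_upper (R : realType) (n : nat) (c : coloring n) : (2 < n)%N ->
  wR R n * ('C(n, 2)%:R - coloring_packing R c) <= 2 * 'C(n, 2)%:R.
Proof.
move=> n3; set M : R := 'C(n, 2)%:R; set D := M - _.
have M0 : 0 < M by rewrite ltr0n bin_gt0 ltnW.
have D0 : 0 < D by have := coloring_packing_le R n c; rewrite -/M /D; lra.
have [wR0|wR0] := leP (wR R n) 0; first by nra.
have main eps : 0 < eps < D -> wR R n * (D - eps) <= 2 * M.
  move=> /andP[eps0 epsD]; have eps2 : 0 < eps / 2 by rewrite divr_gt0.
  have /choice[t tP] := fun b =>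
    approx_triangle_cover R _ (color_class c b) (eps / 2) eps2.
  (* Each edge takes its weight from the cover of its own color. *)
  pose u e := t (c e) e.
  have uE b e : e \in color_class c b -> u e = t b e.
    by rewrite inE /u => /andP[_ /eqP ->].
  have u01 e : 0 <= u e <= 1 by case: (tP (c e)) => + _ _; exact.
  pose S := \sum_(e in complete_edges 'I_n) u e.
  have SD : S <= coloring_packing R c + eps.
    rewrite /S -(sum_color_classes R n c) /coloring_packing.
    have [_ _ tT] := tP true; have [_ _ tF] := tP false.
    rewrite (eq_bigr _ (uE true)) (eq_bigr _ (uE false)); lra.
  have MS : 0 < M - S by move: SD epsD; rewrite /D; lra.
  have sum1 : \sum_(e in complete_edges 'I_n) (1 - u e) = M - S.
    by rewrite sumrB sumr_const card_draws card_ord.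
  have feas : wR_feasible_for c (fun e => (1 - u e) * (M / (M - S)))
      (2 * (M / (M - S))).
    have s0 : 0 <= M / (M - S) by rewrite divr_ge0 // ltW.
    split.
    - by move=> e _; rewrite mulr_ge0 // subr_ge0; case/andP: (u01 e).
    - by rewrite -mulr_suml sum1 mulrC divfK // gt_eqF.
    - move=> H; rewrite complete_triangle => /eqP H3 b.
      rewrite -mulr_suml ler_wpM2r //.
      pose A := [set e in color_class c b | e \subset H]%SET.
      pose A' := [set e in complete_edges 'I_n | e \subset H]%SET.
      have AA' : A \subset A'.
        apply/fintype.subsetP => e; rewrite !inE => /andP[/andP[-> _] ->].
        by [].
      have A'3 : #|A'| = 3%N by rewrite card_edges_inside H3.
      have sumA F : \sum_(e in color_class c b | e \subset H) F e =
          \sum_(e in A) F e :> R.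
        by apply: eq_bigl => e; rewrite [RHS]inE.
      rewrite sumA sumrB sumr_const.
      (* At most two edges of color [b] weigh at most 2 since [u] is nonnegative; three form a
         monochromatic triangle, where the cover lowers 3 to at most 2. *)
      have [A2|A3] := leqP #|A| 2.
        rewrite lerBlDl; apply: le_trans (_ : 2 <= _); first by rewrite ler_nat.
        by rewrite lerDr sumr_ge0 // => e _; case/andP: (u01 e).
      have AE : A = A' by apply/eqP; rewrite eqEcard AA' A'3.
      have tH : H \in triangles (color_class c b).
        rewrite inE H3 eqxx -/A' -AE /=; apply/fintype.subsetP => e.
        by rewrite inE => /andP[].
      have [_ /(_ H tH) + _] := tP b.
      have -> : \sum_(e in color_class c b | e \subset H) t b e =
          \sum_(e in A) u e.
        by rewrite -sumA; apply: eq_bigr => e /andP[/uE].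
      by rewrite AE A'3; lra.
  have [_ wRmin] := wR_min R n3.
  have /wRmin : wR_feasible n (2 * (M / (M - S))).
    by exists (fun e => (1 - u e) * (M / (M - S))), c.
  rewrite mulrA ler_pdivlMr //; apply: le_trans.
  by rewrite ler_pM2l //; move: SD; rewrite /D; lra.
apply/ler_addgt0Pr => e e0.
(* [D / 2] keeps [eps] below [D]; the other term bounds the loss [eps * wR R n] by [e]. *)
pose eps := Num.min (D / 2) (e / wR R n).
have eps0 : 0 < eps by rewrite lt_min !divr_gt0.
have epsD : eps <= D / 2 by rewrite ge_min lexx.
have : eps * wR R n <= e by rewrite -ler_pdivlMr // ge_min lexx orbT.
have := main eps; rewrite eps0 /= => /(_ _); lra.
Qed.

(** * Vertex deletion and monotonicity of the packing density *)

Definition pull_graph (U V : finType) (f : U -> V) (G : {set {set V}}) :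
    {set {set U}} := [set e in complete_edges U | f @: e \in G]%SET.

Lemma imset_triangle (U V : finType) (f : U -> V) (G : {set {set V}})
    (S : {set U}) : injective f ->
  ((f @: S)%SET \in triangles G) = (S \in triangles (pull_graph U V f G)).
Proof.
move=> finj; rewrite !inE card_imset //; congr (_ && _).
apply/fintype.subsetP/fintype.subsetP => H e; rewrite inE => /andP[e2 eS].
  rewrite inE e2 /=; apply: H; rewrite !inE card_imset // imsetS // andbT.
  by move: e2; rewrite inE.
(* An edge inside the image of [S] is the image of its preimage, so the triangle condition transfers
   back along [f]. *)
have e_im : (f @: (f @^-1: e))%SET = e.
  apply/setP => y; apply/imsetP/idP => [[x + ->]|ye]; first by rewrite inE.
  have /imsetP[x xS yx] := fintype.subsetP eS y ye.
  by exists x => //; rewrite inE -yx.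
have := H (f @^-1: e)%SET; rewrite !inE e_im => H'.
have /H'/andP[] // : (#|(f @^-1: e)%SET| == 2) && (f @^-1: e \subset S).
rewrite -(card_imset _ finj) e_im; apply/andP; split; first by rewrite inE in e2.
apply/fintype.subsetP => x; rewrite inE => /(fintype.subsetP eS)/imsetP[y yS].
by move=> /finj ->.
Qed.

Definition restrict_coloring (n : nat) (c : coloring n.+1) (v : 'I_n.+1) :
  coloring n := [ffun S : {set 'I_n} => c (lift v @: S)%SET].

Lemma restrict_color_class (n : nat) (c : coloring n.+1) (v : 'I_n.+1) b :
  color_class (restrict_coloring n c v) b =
  pull_graph _ _ (lift v) (color_class c b).
Proof.
apply/setP => e; rewrite !inE ffunE card_imset; last exact: lift_inj.
by case: (#|e| == 2).
Qed.

Lemma imset_preimset_lift (n : nat) (v : 'I_n.+1) (T : {set 'I_n.+1}) :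
  v \notin T -> (lift v @: (lift v @^-1: T))%SET = T.
Proof.
move=> vT; apply/setP => y; apply/imsetP/idP => [[x + ->]|yT].
  by rewrite inE.
have vy : v != y by apply: contraNneq vT => ->.
have [x yx] := unlift_some vy.
by exists x => //; rewrite inE -yx.
Qed.

Lemma preimset_imset_lift (n : nat) (v : 'I_n.+1) (S : {set 'I_n}) :
  (lift v @^-1: (lift v @: S))%SET = S.
Proof. by apply/setP => x; rewrite inE mem_imset //; exact: lift_inj. Qed.

Lemma sum_triangles_avoiding (R : realType) (n : nat) (G : {set {set 'I_n.+1}})
    (v : 'I_n.+1) (Q : pred {set 'I_n.+1}) (F : {set 'I_n} -> R) :
  \sum_(T | (T \in triangles G) && Q T && (v \notin T)) F (lift v @^-1: T)%SET =
  \sum_(S in triangles (pull_graph _ _ (lift v) G) | Q (lift v @: S)%SET) F S.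
Proof.
rewrite (reindex_onto (fun S : {set 'I_n} => lift v @: S)%SET
  (fun T => lift v @^-1: T)%SET) /=; last first.
  by move=> T /andP[_ /imset_preimset_lift].
apply: eq_big => [S|S _]; last by rewrite preimset_imset_lift.
rewrite preimset_imset_lift eqxx andbT imset_triangle; last exact: lift_inj.
suff -> : v \notin (lift v @: S)%SET by rewrite andbT.
by apply/imsetP => -[x _ vx]; have := neq_lift v x; rewrite -vx eqxx.
Qed.

(* The sum of optimal packings of the vertex-deleted subgraphs uses every edge
   at most m.+1 times, once for each deleted vertex outside the edge. *)
Lemma packing_average (R : realType) (m : nat) (G : {set {set 'I_m.+3}}) :
  G \subset complete_edges 'I_m.+3 ->
  \sum_v packing_number R (pull_graph _ _ (lift v) G) <=
    m.+1%:R * packing_number R G.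
Proof.
move=> GE; have /choice[g gP] := fun v : 'I_m.+3 =>
  packing_number_max R (pull_graph _ _ (lift v) G).
have g0 v S : S \in triangles (pull_graph _ _ (lift v) G) -> 0 <= g v S.
  by case: (gP v) => -[+ _] _ _; apply.
have gsum v : packing_number R (pull_graph _ _ (lift v) G) =
    \sum_(S in triangles (pull_graph _ _ (lift v) G)) g v S.
  by case: (gP v).
have [_ [_ _ gmax]] := packing_number_max R G.
pose h (T : {set 'I_m.+3}) : R :=
  (\sum_(v | v \notin T) g v (lift v @^-1: T)%SET) / m.+1%:R.
have m0 : 0 < m.+1%:R :> R by rewrite ltr0n.
have hsum (Q : pred {set 'I_m.+3}) : \sum_(T in triangles G | Q T) h T =
    (\sum_v \sum_(S in triangles (pull_graph _ _ (lift v) G) |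
              Q (lift v @: S)%SET) g v S) / m.+1%:R.
  rewrite -mulr_suml; congr (_ / _).
  rewrite (exchange_big_dep predT) //=; apply: eq_bigr => v _.
  by rewrite sum_triangles_avoiding.
suff : fractional_packing G h.
  move=> /gmax; have := hsum predT; rewrite !big_mkcondr /= => ->.
  rewrite ler_pdivrMr // mulrC; apply: le_trans.
  rewrite le_eqVlt; apply/orP; left; apply/eqP; apply: eq_bigr => v _.
  by rewrite gsum big_mkcondr.
split=> [T tT|e eG].
  apply: divr_ge0; last exact: ltW.
  apply: sumr_ge0 => v vT; apply: g0.
  by rewrite -imset_triangle ?imset_preimset_lift //; exact: lift_inj.
rewrite hsum ler_pdivrMr // mul1r.
have ec : #|e| = 2%N.
  by have := fintype.subsetP GE e eG; rewrite inE => /eqP.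
have -> : m.+1%:R = \sum_(v | v \notin e) 1 :> R.
  rewrite sumr_const; congr (_%:R); apply/eqP.
  rewrite -(eqn_add2l #|e|) ec.
  rewrite -[X in _ == (_ + X)%N](eq_card (A := ~: e)); last first.
    by move=> v; rewrite !inE.
  by rewrite -ec cardsC card_ord ec.
rewrite [leRHS]big_mkcond /=; apply: ler_sum => v _.
(* If [v] is off [e], then [e] survives the deletion and the packing constraint there gives at most
   1; if [v] lies on [e], no triangle avoiding [v] contains [e]. *)
case: ifPn => [ve|/negPn ve].
  have e_im := imset_preimset_lift _ v e ve.
  have eS (S : {set 'I_m.+2}) : (e \subset lift v @: S)%SET =
      (lift v @^-1: e \subset S)%SET.
    by rewrite -[in LHS]e_im sub_imset_pre preimset_imset_lift.
  under eq_bigl do rewrite eS.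
  case: (gP v) => -[_ +] _ _; apply; rewrite !inE e_im eG andbT.
  by rewrite -(card_imset _ (@lift_inj _ v)) e_im ec.
rewrite big1 // => S /andP[_ /fintype.subsetP/(_ v ve)/imsetP[x _ vx]].
by have := neq_lift v x; rewrite -vx eqxx.
Qed.

Lemma bin2_natr (R : realType) (n : nat) :
  2 * 'C(n.+1, 2)%:R = n.+1%:R * n%:R :> R.
Proof.
by rewrite -!natrM mulnC (bin_ffact n.+1 2) ffactnS ffactn1.
Qed.

(** An optimal coloring restricts to a coloring of each vertex-deleted subgraph; [packing_average]
    is then applied to both colors. *)
Lemma tau_star_average (R : realType) (m : nat) :
  m.+3%:R * tau_star R m.+2 <= m.+1%:R * tau_star R m.+3.
Proof.
have [c [-> _]] := tau_star_min R m.+3.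
have [_ [_ tau_min]] := tau_star_min R m.+2.
rewrite mulr_natl -[X in _ *+ X](card_ord m.+3) -sumr_const.
apply: (@le_trans _ _
    (\sum_v coloring_packing R (restrict_coloring m.+2 c v))).
  exact: ler_sum.
rewrite big_split /= mulrDr.
by apply: lerD; under eq_bigr do rewrite restrict_color_class;
  apply: packing_average; exact: color_class_sub.
Qed.

Lemma tau_star_ge0 (R : realType) (n : nat) : 0 <= tau_star R n.
Proof.
have [c [-> _]] := tau_star_min R n.
by rewrite addr_ge0 // packing_number_ge0.
Qed.

Lemma tau_density_le (R : realType) (n : nat) : tau_density R n <= 1 / 3.
Proof.
have [M0|M0] := posnP 'C(n, 2).
  by rewrite /tau_density M0 invr0 mulr0; lra.
have [c [E _]] := tau_star_min R n.
rewrite /tau_density ler_pdivrMr ?ltr0n // E.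
by have := coloring_packing_le R n c; lra.
Qed.

Lemma tau_density_nondecreasing (R : realType) :
  {homo tau_density R : n m / (n <= m)%N >-> n <= m}.
Proof.
(* For 0 and 1 vertices the binomial is 0, and division by 0 gives density 0. *)
apply/nondecreasing_seqP => -[|[|m]].
- by rewrite /tau_density !invr0 !mulr0.
- by rewrite /tau_density invr0 mulr0 divr_ge0 // tau_star_ge0.
have half n : 'C(n.+1, 2)%:R = n.+1%:R * n%:R / 2 :> R.
  by rewrite -bin2_natr; field.
have p k : 0 < k.+1%:R :> R by rewrite ltr0n.
rewrite /tau_density !half.
rewrite ler_pdivrMr; last by rewrite divr_gt0 ?mulr_gt0.
rewrite mulrAC ler_pdivlMr; last by rewrite divr_gt0 ?mulr_gt0.
have := tau_star_average R m; have := p m.+1.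
set a := m.+3%:R; set b := m.+2%:R; set d := m.+1%:R.
nra.
Qed.

Lemma tau_density_cvg (R : realType) : cvgn (tau_density R).
Proof.
apply: nondecreasing_is_cvgn; first exact: tau_density_nondecreasing.
by exists (1 / 3) => _ [n _ <-]; exact: tau_density_le.
Qed.

(** * Squeezing and passage to the limit *)

Lemma wR_bounds (R : realType) (n : nat) : (2 < n)%N ->
  2 / (1 - tau_density R n + n%:R / 'C(n, 2)%:R) <= wR R n
    <= 2 / (1 - tau_density R n).
Proof.
move=> n3; have M0 : 0 < 'C(n, 2)%:R :> R by rewrite ltr0n bin_gt0 ltnW.
have tau13 := tau_density_le R n.
have tauE : tau_star R n = tau_density R n * 'C(n, 2)%:R.
  by rewrite /tau_density divfK // gt_eqF.
have e0 : 0 <= n%:R / 'C(n, 2)%:R :> R by rewrite divr_ge0.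
have nE : n%:R = n%:R / 'C(n, 2)%:R * 'C(n, 2)%:R :> R.
  by rewrite divfK // gt_eqF.
apply/andP; split; last first.
  rewrite ler_pdivlMr; last by lra.
  have [c [E _]] := tau_star_min R n.
  have := wR_upper R n c n3; rewrite -E tauE; nra.
rewrite ler_pdivrMr; last by lra.
have [[w [c wc]] _] := wR_min R n3.
have [_ [_ /(_ c) tau_c]] := tau_star_min R n.
have := wR_feasible_lower R n c w (wR R n) n3 wc.
have cp := coloring_packing_le R n c.
move: tau_c e0 nE; rewrite tauE.
set e := n%:R / _; set q := wR R n; set d := tau_density R n in tau13 *.
set M := 'C(n, 2)%:R in M0 cp *; set p := coloring_packing R c in cp *.
move=> dp e0 eE; rewrite eE => low.
have eM0 : 0 <= e * M by rewrite mulr_ge0 // ltW.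
(* The sign of [q] is needed to replace the packing of [c] by the smaller [tau_star] in the factor
   multiplied by [q]. *)
have q0 : 0 <= q.
  have D0 : 0 < M - p + e * M by lra.
  by rewrite -(pmulr_lge0 _ D0); lra.
rewrite -(ler_pM2r M0); apply: le_trans low _.
by rewrite -[leRHS]mulrA ler_wpM2l //; lra.
Qed.

Lemma nat_over_bin2_cvg (R : realType) :
  (fun n => n%:R / 'C(n, 2)%:R : R) @ \oo --> (0 : R).
Proof.
(* The quotient is [2 / (n - 1)] for [n] at least 2; shifting by 2 turns it into twice the harmonic
   sequence [1 / (n + 1)]. *)
rewrite -(cvg_shiftn 2).
rewrite (_ : [sequence _]_n = (fun n => 2 * harmonic n)); last first.
  apply/funext => n; rewrite /= addn2 /harmonic.
  have := bin2_natr R n.+1.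
  move=> H; have -> : 'C(n.+2, 2)%:R = n.+2%:R * n.+1%:R / 2 :> R.
    by rewrite -H; field.
  by field; rewrite nat1r -natrD !pnatr_eq0.
have := cvgM (cvg_cst (2 : R)) (@cvg_harmonic R).
rewrite mulr0; exact.
Qed.

Theorem theorem5 (R : realType) :
  [/\ cvgn (wR R), cvgn (tau_density R) & W3 R = 2 / (1 - tau3 R)].
Proof.
have ctau := tau_density_cvg R.
(* This keeps the limit of the denominators away from 0, so inversion is continuous there. *)
have tau13 : tau3 R <= 1 / 3.
  by apply: limr_le => //; near=> n; exact: tau_density_le.
have c1 : (fun n => 1 - tau_density R n) @ \oo --> 1 - tau3 R.
  by apply: cvgB; [exact: cvg_cst|exact: ctau].
have upper : (fun n => 2 / (1 - tau_density R n)) @ \oo --> 2 / (1 - tau3 R).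
  apply: cvgM; first exact: cvg_cst.
  by apply: cvgV => //; rewrite gt_eqF //; lra.
have lower : (fun n => 2 / (1 - tau_density R n + n%:R / 'C(n, 2)%:R)) @ \oo
    --> 2 / (1 - tau3 R).
  apply: cvgM; first exact: cvg_cst.
  apply: cvgV; first by rewrite gt_eqF //; lra.
  by rewrite -[1 - tau3 R]addr0; apply: cvgD => //; exact: nat_over_bin2_cvg.
have cwR : wR R @ \oo --> 2 / (1 - tau3 R).
  apply: squeeze_cvgr lower upper; near=> n; apply: wR_bounds.
  by near: n; exact: nbhs_infty_gt.
split=> //; first by apply/cvg_ex; eexists; exact: cwR.
exact: cvg_lim cwR.
Unshelve. all: by end_near.
Qed.
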